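(* Let $(\lambda,T)\in N$, $\lambda=(\theta,c,\alpha)$, and $q(T)=(x_1(T),x_2(T),y(T),z(T))=\mathrm{Exp}(\lambda,T)$. Then: 1. $(\lambda,T)\in\mathrm{MAX}^1$ if and only if $x_2(T)=y(T)=z(T)=0$ and, if $\lambda\in C_0^0$, then $\theta\ne0$. 2. $(\lambda,T)\in\mathrm{MAX}^2$ if and only if either $\lambda\in C^+\cup C^-$, $y(T)=0$ and $\tau\neq0$, or $\lambda\in C^0$ and $y(T)=0$. 3. $(\lambda,T)\in\mathrm{MAX}^3$ if and only if $x_2(T)=0$, $z(T)=\frac{x_1(T)y(T)}{2}$ and, if $\lambda\in C^0\cup C_0^0$, then $\theta\neq-\frac{cT}{2}$.
   Context: The Engel group is $\mathbb{R}^4$ with coordinates $q=(x_1,x_2,y,z)$ and left-invariant fields $X_1=\partial_{x_1}-\frac{x_2}{2}\partial_y$, $X_2=\partial_{x_2}+\frac{x_1}{2}\partial_y+\frac{x_1^2+x_2^2}{2}\partial_z$, $X_3=\partial_y+x_1\partial_z$, $X_4=\partial_z$; the sub-Lorentzian metric on $\mathrm{span}\{X_1,X_2\}$ is $g(X_1,X_1)=-1$, $g(X_2,X_2)=1$, $g(X_1,X_2)=0$. Put $h_i=\langle\xi,X_i\rangle$ for a covector $\xi$ and $H=\frac12(-h_1^2+h_2^2)$. Timelike normal extremals on the level $H=-1/2$ with $h_1=\cosh\theta$, $h_2=\sinh\theta$, $h_3=c$, $h_4=\alpha$ satisfy $$\dot x_1=-\cosh\theta,\ \dot x_2=\sinh\theta,\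 \dot y=\tfrac12(x_2\cosh\theta+x_1\sinh\theta),\ \dot z=\tfrac{x_1^2+x_2^2}{2}\sinh\theta,\ \dot\theta=-c,\ \dot c=-\alpha\cosh\theta,\ \dot\alpha=0,$$ with $q(0)=0$. Let $C=\{\lambda=(\theta,c,\alpha)\in\mathbb{R}^3\}$, $C_0^0=\{c=0,\alpha=0\}$, $C^0=\{c\neq0,\alpha=0\}$, $C^+=\{\alpha>0\}$, $C^-=\{\alpha<0\}$. For $\lambda\in C$ let $t_{\mathrm{supr}}(\lambda)\in(0,+\infty]$ be the explosion (maximal forward existence) time of the solution with initial values $\lambda$, $q(0)=0$; let $N=\{(\lambda,t): \lambda\in C,\ 0<t<t_{\mathrm{supr}}(\lambda)\}$ and $\mathrm{Exp}:N\to\mathbb{R}^4$, $\mathrm{Exp}(\lambda,t)=q(t)$. Let $e^{t\vec H_v}$ be the flow of the vertical system $\dot\theta=-c$, $\dot c=-\alpha\cosh\theta$, $\dot\alpha=0$ on $C$. Define maps on $C$ by $\varepsilon^1(\theta,c,\alpha)=(-\theta,-c,-\alpha)$, $\varepsilon^2(\theta,c,\alpha)=(\theta,-c,\alpha)$, $\varepsilon^3(\theta,c,\alpha)=(-\theta,c,-\alpha)$. For $(\lambda,t)\in N$ put $\lambda^1=\varepsilon^1(\lambda)$ and $\lambda^i=\varepsilon^i(e^{t\vec H_v}(\lambda))$ for $i=2,3$. The Maxwell sets are $$\mathrm{MAX}^i=\{(\lambda,t)\in N:\ \lambda^i\ne\lambda,\ \mathrm{Exp}(\lambda^i,t)=\mathrm{Exp}(\lambda,t)\},\quad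 i=1,2,3.$$ The coordinate $\tau$: for $\lambda\in C^+$ put $E=\frac{c^2}{2}-\alpha\sinh\theta$, $\kappa=\sqrt{\tfrac12\sqrt{E^2+\alpha^2}}$, $k^2=\frac12+\frac{E}{4\kappa^2}\in(0,1)$, and let $\psi_0=\psi_0(\lambda)\in(-K(k),K(k))$ be defined by $c=-2\kappa\,\frac{\mathrm{sn}\,\psi_0}{\mathrm{cn}\,\psi_0}\,\mathrm{dn}\,\psi_0$ (Jacobi functions of modulus $k$, $K(k)$ the complete elliptic integral of the first kind); for $\lambda\in C^-$ put $\kappa(\lambda)=\kappa(\varepsilon^1(\lambda))$, $k(\lambda)=k(\varepsilon^1(\lambda))$, $\psi_0(\lambda)=\psi_0(\varepsilon^1(\lambda))$. For time $T$ let $\psi_T=\psi_0+\kappa T$ and $\tau=\frac{\psi_T+\psi_0}{2}$ (here $t_{\mathrm{supr}}(\lambda)=(K(k)-\psi_0)/\kappa$).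
   Formalization: In item 3 the condition θ ≠ −cT/2 is corrected to θ ≠ cT/2: with θ' = −c one has λ³ = λ exactly when α = 0 and θ = cT/2, and the printed sign fails for λ = (1,1,0), T = 2. *)

(* Defs.v *)
From Stdlib Require Import Reals ClassicalEpsilon.
From Coquelicot Require Import Coquelicot.
Open Scope R_scope.

Record covector := Covector { theta : R; c : R; alpha : R }.

Record point := Point { x1 : R; x2 : R; y : R; z : R }.

Definition origin : point := Point 0 0 0 0.

Definition C_00 (l : covector) : Prop := c l = 0 /\ alpha l = 0.
Definition C_0 (l : covector) : Prop := c l <> 0 /\ alpha l = 0.
Definition C_pos (l : covector) : Prop := alpha l > 0.
Definition C_neg (l : covector) : Prop := alpha l < 0.

(* A solution on the closed segment [0, T] is represented by functions on the
   whole line whose values outside [0, T] are irrelevant; asking for two-sided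
   derivatives at the two endpoints is harmless, because a curve which is C^1
   on [0, T] can be prolonged affinely. *)
Definition vertical_solution (l : R -> covector) (T : R) : Prop :=
  forall t, 0 <= t <= T ->
    is_derive (fun s => theta (l s)) t (- c (l t)) /\
    is_derive (fun s => c (l s)) t (- alpha (l t) * cosh (theta (l t))) /\
    is_derive (fun s => alpha (l s)) t 0.

Definition horizontal_solution (l : R -> covector) (q : R -> point) (T : R)
  : Prop :=
  forall t, 0 <= t <= T ->
    is_derive (fun s => x1 (q s)) t (- cosh (theta (l t))) /\
    is_derive (fun s => x2 (q s)) t (sinh (theta (l t))) /\
    is_derive (fun s => y (q s)) t
      (/ 2 * (x2 (q t) * cosh (theta (l t)) + x1 (q t) * sinh (theta (l t)))) /\
    is_derive (fun s => z (q s)) t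
      ((x1 (q t) ^ 2 + x2 (q t) ^ 2) / 2 * sinh (theta (l t))).

Definition extremal (l0 : covector) (T : R) (l : R -> covector) (q : R -> point)
  : Prop :=
  l 0 = l0 /\ q 0 = origin /\ vertical_solution l T /\ horizontal_solution l q T.

Definition t_supr (l0 : covector) : Rbar :=
  Lub_Rbar (fun T => 0 <= T /\ exists l q, extremal l0 T l q).

Definition domN (l : covector) (t : R) : Prop :=
  0 < t /\ Rbar_lt t (t_supr l).

(* The endpoint is uniquely determined for (l0, t) in domN; the value outside
   domN is junk. *)
Definition Exp (l0 : covector) (t : R) : point :=
  epsilon (inhabits origin)
    (fun p => exists l q, extremal l0 t l q /\ p = q t).

(* Forward-time flow of the vertical system; junk past the explosion time. *)
Definition flow (t : R) (l0 : covector) : covector :=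
  epsilon (inhabits l0)
    (fun p => exists l, l 0 = l0 /\ vertical_solution l t /\ p = l t).

Definition eps1 (l : covector) := Covector (- theta l) (- c l) (- alpha l).
Definition eps2 (l : covector) := Covector (theta l) (- c l) (alpha l).
Definition eps3 (l : covector) := Covector (- theta l) (c l) (- alpha l).

Definition lam1 (l : covector) (t : R) : covector := eps1 l.
Definition lam2 (l : covector) (t : R) : covector := eps2 (flow t l).
Definition lam3 (l : covector) (t : R) : covector := eps3 (flow t l).

(* Sign check: when alpha l = 0 the flow is theta(t) = theta l - c l * t with c
   constant, so lam3 l t = l exactly when theta l = c l * t / 2. *)

(* The maps lam1, lam2, lam3 send solutions on [0, t] to solutions on [0, t]
   (for lam2 and lam3, with time reversed), so Exp (lam l t) t is a genuine
   endpoint whenever (l, t) is in domN. *)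
Definition Maxwell (lam : covector -> R -> covector) (l : covector) (t : R)
  : Prop :=
  domN l t /\ lam l t <> l /\ Exp (lam l t) t = Exp l t.

Definition MAX1 := Maxwell lam1.
Definition MAX2 := Maxwell lam2.
Definition MAX3 := Maxwell lam3.

(* Jacobi functions, in terms of the modulus k (not the parameter m = k^2). *)
Definition ellF (k phi : R) : R :=
  RInt (fun s => / sqrt (1 - k ^ 2 * sin s ^ 2)) 0 phi.
Definition ellK (k : R) : R := ellF k (PI / 2).
Definition am (k u : R) : R := epsilon (inhabits 0) (fun phi => ellF k phi = u).
Definition sn (k u : R) : R := sin (am k u).
Definition cn (k u : R) : R := cos (am k u).
Definition dn (k u : R) : R := sqrt (1 - k ^ 2 * sn k u ^ 2).

Definition energy (l : covector) : R := c l ^ 2 / 2 - alpha l * sinh (theta l).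

Definition kappa_plus (l : covector) : R :=
  sqrt (/ 2 * sqrt (energy l ^ 2 + alpha l ^ 2)).
Definition k_plus (l : covector) : R :=
  sqrt (/ 2 + energy l / (4 * kappa_plus l ^ 2)).
Definition psi0_plus (l : covector) : R :=
  epsilon (inhabits 0)
    (fun psi =>
       - ellK (k_plus l) < psi < ellK (k_plus l) /\
       c l = - 2 * kappa_plus l * (sn (k_plus l) psi / cn (k_plus l) psi)
             * dn (k_plus l) psi).

(* On C_neg the quantities are those of eps1 l; they are meaningless when
   alpha l = 0. *)
Definition to_plus (l : covector) : covector :=
  if Rlt_dec 0 (alpha l) then l else eps1 l.
Definition kappa (l : covector) : R := kappa_plus (to_plus l).
Definition psi0 (l : covector) : R := psi0_plus (to_plus l).

Definition tau (l : covector) (T : R) : R :=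
  let psiT := psi0 l + kappa l * T in (psiT + psi0 l) / 2.

(* Main.v *)
(** Each [eps_i] lifts to a symmetry of the full extremal system: a sign change for
    [eps1], and time reversal followed by a left translation and a sign change for
    [eps2] and [eps3].  Hence, if [Exp l T] is [(x1, x2, y, z)], then [lam1], [lam2]
    and [lam3] have endpoints [(x1, - x2, - y, - z)], [(x1, x2, - y, z - x1 y)] and
    [(x1, - x2, y, x1 y - z)], and the Maxwell equations can be read off.  It remains
    to decide when [lam_i = l].  For [alpha > 0], conservation of energy gives
    [c' = - sqrt (alpha^2 + (c^2 / 2 - E)^2)], so an odd increasing primitive [clock]
    of the reciprocal of this speed satisfies [clock (c t) = clock (c 0) - t].  This
    yields uniqueness of solutions, and shows that [lam2 = l], i.e. [c T = - c 0],
    exactly when [T = 2 clock (c 0)].  Legendre's substitution gives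
    [psi0 = - kappa clock (c 0)], which turns this condition into [tau = 0]. *)
Require Import Defs.
From Stdlib Require Import Reals Lra Classical ClassicalEpsilon.
From Coquelicot Require Import Coquelicot.
Open Scope R_scope.

(** * Functions with equal derivatives, and primitives based at 0 *)

Lemma eq_of_same_derive (f g d : R -> R) (a b : R) :
  (forall t, Rmin a b <= t <= Rmax a b ->
     is_derive f t (d t) /\ is_derive g t (d t)) ->
  f a = g a -> f b = g b.
Proof.
  intros H Ha.
  assert (D : forall t, Rmin a b <= t <= Rmax a b ->
            is_derive (fun s => f s - g s) t 0).
  { intros t Ht. destruct (H t Ht) as [Hf Hg].
    replace 0 with (d t - d t) by ring.
    now apply (is_derive_minus (V := R_NormedModule)). }
  destruct (MVT_gen (fun s => f s - g s) a b (fun _ => 0)) as [m [_ Hm]].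
  - intros t Ht. apply D. lra.
  - intros t Ht. apply derivable_continuous_pt.
    exists 0. apply is_derive_Reals. now apply D.
  - lra.
Qed.

Lemma eq_of_same_derive_forward (f g d : R -> R) (T t : R) :
  (forall s, 0 <= s <= T -> is_derive f s (d s) /\ is_derive g s (d s)) ->
  f 0 = g 0 -> 0 <= t <= T -> f t = g t.
Proof.
  intros H H0 Ht. apply (eq_of_same_derive f g d 0 t); [|exact H0].
  intros s Hs. rewrite Rmin_left, Rmax_right in Hs by lra. apply H. lra.
Qed.

Lemma is_derive_Ropp (f : R -> R) (t d : R) :
  is_derive f t d -> is_derive (fun s => - f s) t (- d).
Proof. apply (is_derive_opp (V := R_NormedModule)). Qed.

Lemma is_derive_zero (a t : R) : is_derive (fun _ => a) t 0.
Proof. apply (is_derive_const (V := R_NormedModule)). Qed.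

Lemma is_derive_RInt_0 (f : R -> R) (u : R) :
  (forall s, continuous f s) -> is_derive (fun v => RInt f 0 v) u (f u).
Proof.
  intros Hf. apply (is_derive_RInt f (fun v => RInt f 0 v) 0 u); [|apply Hf].
  apply filter_forall. intros v. apply (RInt_correct f).
  apply (ex_RInt_continuous f). intros s _. apply Hf.
Qed.

Lemma RInt_0_increasing (f : R -> R) (u v : R) :
  (forall s, continuous f s) -> (forall s, 0 < f s) ->
  u < v -> RInt f 0 u < RInt f 0 v.
Proof.
  intros Hf Hpos Huv.
  destruct (MVT_gen (fun s => RInt f 0 s) u v f) as [m [_ Hm]].
  - intros s _. now apply is_derive_RInt_0.
  - intros s _. apply derivable_continuous_pt.
    exists (f s). apply is_derive_Reals. now apply is_derive_RInt_0.
  - pose proof (Rmult_lt_0_compat _ _ (Hpos m) (proj2 (Rlt_0_minus u v) Huv)).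
    lra.
Qed.

Lemma RInt_0_inj (f : R -> R) (u v : R) :
  (forall s, continuous f s) -> (forall s, 0 < f s) ->
  RInt f 0 u = RInt f 0 v -> u = v.
Proof.
  intros Hf Hpos E. destruct (Rtotal_order u v) as [L|[L|L]]; auto;
    apply (RInt_0_increasing f _ _ Hf Hpos) in L; lra.
Qed.

(** By evenness both sides have derivative [- f], and both vanish at 0. This serves the clock and
    Legendre's integral alike. *)
Lemma RInt_0_odd (f : R -> R) (u : R) :
  (forall s, continuous f s) -> (forall s, f (- s) = f s) ->
  RInt f 0 (- u) = - RInt f 0 u.
Proof.
  intros Hf Heven.
  apply (eq_of_same_derive (fun v => RInt f 0 (- v)) (fun v => - RInt f 0 v)
           (fun v => - f v) 0 u).
  - intros t _. split.
    + rewrite <- (Heven t). replace (- f (- t)) with (scal (-1) (f (- t))).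
      * apply (is_derive_comp (fun v => RInt f 0 v) Ropp t (f (- t)) (-1)).
        -- now apply is_derive_RInt_0.
        -- auto_derive; auto; ring.
      * unfold scal; simpl; unfold mult; simpl; ring.
    + apply is_derive_Ropp. now apply is_derive_RInt_0.
  - rewrite Ropp_0, RInt_point. unfold zero; simpl. ring.
Qed.

(** * Energy and clock *)

Lemma cosh_sqr (u : R) : cosh u ^ 2 = 1 + sinh u ^ 2.
Proof.
  unfold cosh, sinh.
  assert (E : exp u * exp (- u) = 1)
    by (rewrite <- exp_plus, Rplus_opp_r; apply exp_0).
  replace 1 with (exp u * exp (- u)) by exact E. field.
Qed.

Lemma cosh_gt_0 (u : R) : 0 < cosh u.
Proof. unfold cosh. pose proof (exp_pos u). pose proof (exp_pos (- u)). lra. Qed.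

Lemma cosh_opp (u : R) : cosh (- u) = cosh u.
Proof. unfold cosh. rewrite Ropp_involutive. lra. Qed.

Lemma sinh_opp (u : R) : sinh (- u) = - sinh u.
Proof. unfold sinh. rewrite Ropp_involutive. lra. Qed.

Lemma sinh_inj (u v : R) : sinh u = sinh v -> u = v.
Proof. intros E. rewrite <- (arcsinh_sinh u), E. apply arcsinh_sinh. Qed.

Lemma covector_eq (l m : covector) :
  theta l = theta m -> c l = c m -> alpha l = alpha m -> l = m.
Proof. destruct l, m; simpl; congruence. Qed.

Lemma point_eq (p q : point) :
  x1 p = x1 q -> x2 p = x2 q -> y p = y q -> z p = z q -> p = q.
Proof. destruct p, q; simpl; congruence. Qed.

Lemma eps1_involutive (l : covector) : eps1 (eps1 l) = l.
Proof. apply covector_eq; simpl; ring. Qed.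

Ltac rewrite_derive :=
  repeat match goal with
  | H : is_derive _ ?t ?d |- context [Derive ?f ?t] =>
      rewrite (is_derive_unique f t d H)
  end.

(** [auto_derive] leaves the derivatives of abstract functions as [Derive f t]; their values are
    then read off from the hypotheses. *)
Ltac derive_known :=
  auto_derive; [ repeat split; eexists; eassumption
               | rewrite_derive; try field ].

Lemma alpha_constant (L : R -> covector) (T t : R) :
  vertical_solution L T -> 0 <= t <= T -> alpha (L t) = alpha (L 0).
Proof.
  intros V Ht.
  apply (eq_of_same_derive_forward (fun s => alpha (L s)) (fun _ => alpha (L 0))
           (fun _ => 0) T t); auto.
  intros s Hs. split; [apply V, Hs | apply is_derive_zero].
Qed.

(** The contribution [- alpha c cosh theta] of [c c'] cancels against that of
    [- alpha theta' cosh theta]. *)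
Lemma energy_constant (L : R -> covector) (T t : R) :
  vertical_solution L T -> 0 <= t <= T -> energy (L t) = energy (L 0).
Proof.
  intros V Ht.
  apply (eq_of_same_derive_forward (fun s => energy (L s))
           (fun _ => energy (L 0)) (fun _ => 0) T t); auto.
  intros s Hs. split; [|apply is_derive_zero].
  destruct (V s Hs) as (D1 & D2 & D3).
  (* Naming the components makes them atoms for [auto_derive]. *)
  set (th := fun r => theta (L r)) in D1.
  set (h3 := fun r => c (L r)) in D2.
  set (h4 := fun r => alpha (L r)) in D3.
  change (is_derive (fun r => h3 r ^ 2 / 2 - h4 r * sinh (th r)) s 0).
  derive_known. unfold h3, h4, th. field.
Qed.

(* The reciprocal of the speed of [c] on the level [energy = e]:
   [alpha * cosh theta = sqrt (alpha^2 + (alpha * sinh theta)^2)]. *)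
Definition slowness (a e s : R) : R := / sqrt (a ^ 2 + (s ^ 2 / 2 - e) ^ 2).

Definition clock (l : covector) (s : R) : R :=
  RInt (slowness (alpha l) (energy l)) 0 s.

Lemma slowness_radicand_pos (a e s : R) :
  0 < a -> 0 < a ^ 2 + (s ^ 2 / 2 - e) ^ 2.
Proof.
  intros Ha. pose proof (pow_lt a 2 Ha). pose proof (pow2_ge_0 (s ^ 2 / 2 - e)).
  lra.
Qed.

Lemma slowness_pos (a e s : R) : 0 < a -> 0 < slowness a e s.
Proof.
  intros Ha. now apply Rinv_0_lt_compat, sqrt_lt_R0, slowness_radicand_pos.
Qed.

Lemma slowness_continuous (a e s : R) : 0 < a -> continuous (slowness a e) s.
Proof.
  intros Ha. apply (ex_derive_continuous (slowness a e)). unfold slowness.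
  pose proof (slowness_radicand_pos a e s Ha) as P.
  auto_derive. split.
  - replace (s * (s * 1) * / 2 + - e) with (s ^ 2 / 2 - e) by (simpl; field).
    simpl in P |- *; lra.
  - split; auto. apply Rgt_not_eq, sqrt_lt_R0. simpl in P |- *; unfold Rdiv in P; lra.
Qed.

Lemma clock_inj (l : covector) (u v : R) :
  0 < alpha l -> clock l u = clock l v -> u = v.
Proof.
  intros Ha. apply RInt_0_inj; intros s.
  - now apply slowness_continuous.
  - now apply slowness_pos.
Qed.

Lemma clock_opp (l : covector) (u : R) :
  0 < alpha l -> clock l (- u) = - clock l u.
Proof.
  intros Ha. apply RInt_0_odd; intros s.
  - now apply slowness_continuous.
  - unfold slowness. now replace ((- s) ^ 2) with (s ^ 2) by ring.
Qed.

Lemma is_derive_clock (l : covector) (f : R -> R) (t d : R) :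
  0 < alpha l -> is_derive f t d ->
  is_derive (fun s => clock l (f s)) t (d * slowness (alpha l) (energy l) (f t)).
Proof.
  intros Ha H.
  apply (is_derive_comp (clock l) f t (slowness (alpha l) (energy l) (f t)) d); auto.
  apply is_derive_RInt_0. intros s. now apply slowness_continuous.
Qed.

Lemma slowness_on_level (l : covector) :
  0 < alpha l ->
  slowness (alpha l) (energy l) (c l) = / (alpha l * cosh (theta l)).
Proof.
  intros Ha. unfold slowness. f_equal.
  rewrite <- (sqrt_pow2 (alpha l * cosh (theta l))).
  - f_equal. rewrite Rpow_mult_distr, cosh_sqr. unfold energy. field.
  - apply Rlt_le, Rmult_lt_0_compat; auto using cosh_gt_0.
Qed.

Lemma clock_runs_backwards (L : R -> covector) (T t : R) :
  0 < alpha (L 0) -> vertical_solution L T -> 0 <= t <= T ->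
  clock (L 0) (c (L t)) = clock (L 0) (c (L 0)) - t.
Proof.
  intros Ha V Ht.
  apply (eq_of_same_derive_forward (fun s => clock (L 0) (c (L s)))
           (fun s => clock (L 0) (c (L 0)) - s) (fun _ => -1) T t); auto; [|ring].
  intros s Hs. split; [|auto_derive; auto; ring].
  destruct (V s Hs) as (_ & D2 & _).
  apply (is_derive_clock (L 0) _ _ _ Ha) in D2. simpl in D2.
  (* The clock is built from the data at time 0; conservation moves them to time [s], where the
     slowness is the reciprocal of the current speed of [c]. *)
  rewrite <- (alpha_constant L T s V Hs) in Ha, D2.
  rewrite <- (energy_constant L T s V Hs), (slowness_on_level (L s) Ha) in D2.
  replace (-1) with (- alpha (L s) * cosh (theta (L s))
                     * / (alpha (L s) * cosh (theta (L s)))); [exact D2|].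
  pose proof (cosh_gt_0 (theta (L s))). field. lra.
Qed.

(** * Uniqueness of extremals *)

(** This symmetry carries results from [alpha > 0] over to [alpha < 0]. *)
Lemma vertical_eps1 (L : R -> covector) (T : R) :
  vertical_solution L T -> vertical_solution (fun t => eps1 (L t)) T.
Proof.
  intros V t Ht. destruct (V t Ht) as (D1 & D2 & D3). simpl.
  rewrite cosh_opp. split; [|split].
  - now apply is_derive_Ropp.
  - rewrite <- Ropp_mult_distr_l. now apply is_derive_Ropp.
  - rewrite <- Ropp_0. now apply is_derive_Ropp.
Qed.

(** The injective clock determines [c] at time [t]. Since [alpha] and the energy are conserved and
    the energy is affine in [sinh theta] with slope [- alpha], [theta] is determined too. *)
Lemma vertical_unique_pos (L M : R -> covector) (T t : R) :
  vertical_solution L T -> vertical_solution M T -> L 0 = M 0 ->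
  0 < alpha (L 0) -> 0 <= t <= T -> L t = M t.
Proof.
  intros VL VM E0 Ha Ht.
  assert (Ea : alpha (L t) = alpha (M t)).
  { rewrite (alpha_constant L T t), (alpha_constant M T t); auto. now rewrite E0. }
  assert (Ec : c (L t) = c (M t)).
  { apply (clock_inj (L 0)); auto.
    rewrite (clock_runs_backwards L T t); auto. rewrite E0 in *.
    now rewrite (clock_runs_backwards M T t). }
  apply covector_eq; auto.
  assert (Ee : energy (L t) = energy (M t)).
  { rewrite (energy_constant L T t), (energy_constant M T t); auto. now rewrite E0. }
  rewrite <- (alpha_constant L T t VL Ht) in Ha.
  unfold energy in Ee. rewrite <- Ea, <- Ec in Ee.
  apply sinh_inj, (Rmult_eq_reg_l (alpha (L t))); lra.
Qed.

(** For [alpha = 0] the speed of [c] vanishes and the clock degenerates, so the system is integrated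
    directly. *)
Lemma vertical_zero (L : R -> covector) (T t : R) :
  vertical_solution L T -> alpha (L 0) = 0 -> 0 <= t <= T ->
  L t = Covector (theta (L 0) - c (L 0) * t) (c (L 0)) 0.
Proof.
  intros V Ha.
  assert (Ea : forall t, 0 <= t <= T -> alpha (L t) = 0).
  { intros s Hs. now rewrite (alpha_constant L T s). }
  assert (Ec : forall t, 0 <= t <= T -> c (L t) = c (L 0)).
  { intros s Hs.
    apply (eq_of_same_derive_forward (fun r => c (L r)) (fun _ => c (L 0))
             (fun _ => 0) T s); auto.
    intros r Hr. split; [|apply is_derive_zero].
    destruct (V r Hr) as (_ & D & _). rewrite Ea in D by auto.
    now rewrite Ropp_0, Rmult_0_l in D. }
  intros Ht. apply covector_eq; simpl; auto.
  apply (eq_of_same_derive_forward (fun r => theta (L r))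
           (fun r => theta (L 0) - c (L 0) * r) (fun _ => - c (L 0)) T t); auto.
  - intros r Hr. split.
    + destruct (V r Hr) as (D & _). now rewrite Ec in D.
    + auto_derive; auto; ring.
  - ring.
Qed.

Lemma vertical_unique (L M : R -> covector) (T t : R) :
  vertical_solution L T -> vertical_solution M T -> L 0 = M 0 ->
  0 <= t <= T -> L t = M t.
Proof.
  intros VL VM E0 Ht.
  destruct (Rtotal_order (alpha (L 0)) 0) as [Ha|[Ha|Ha]].
  - rewrite <- (eps1_involutive (L t)), <- (eps1_involutive (M t)). f_equal.
    apply (vertical_unique_pos (fun s => eps1 (L s)) (fun s => eps1 (M s)) T t);
      auto using vertical_eps1.
    + now rewrite E0.
    + simpl. lra.
  - rewrite (vertical_zero L T t), (vertical_zero M T t); auto; rewrite <- E0; auto.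
  - now apply (vertical_unique_pos L M T t).
Qed.

(** The horizontal system is triangular: [x1] and [x2] are integrals of functions of [theta], and
    then [y] and [z] are integrals of known functions. Hence the choice made in [Exp] does not
    affect the endpoint. *)
Lemma extremal_unique (l : covector) (T : R) (L M : R -> covector)
  (p q : R -> point) :
  0 <= T -> extremal l T L p -> extremal l T M q -> p T = q T.
Proof.
  intros HT (L0 & p0 & VL & Hp) (M0 & q0 & VM & Hq).
  assert (EL : forall t, 0 <= t <= T -> M t = L t).
  { intros t Ht. apply (vertical_unique M L T t); auto; congruence. }
  assert (E1 : forall t, 0 <= t <= T -> x1 (q t) = x1 (p t)).
  { intros t Ht.
    apply (eq_of_same_derive_forward (fun s => x1 (q s)) (fun s => x1 (p s))
             (fun s => - cosh (theta (L s))) T t); auto; [|now rewrite q0, p0].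
    intros s Hs. split; [rewrite <- EL by auto; apply Hq, Hs | apply Hp, Hs]. }
  assert (E2 : forall t, 0 <= t <= T -> x2 (q t) = x2 (p t)).
  { intros t Ht.
    apply (eq_of_same_derive_forward (fun s => x2 (q s)) (fun s => x2 (p s))
             (fun s => sinh (theta (L s))) T t); auto; [|now rewrite q0, p0].
    intros s Hs. split; [rewrite <- EL by auto; apply Hq, Hs | apply Hp, Hs]. }
  assert (HTT : 0 <= T <= T) by lra.
  symmetry. apply point_eq; auto.
  - apply (eq_of_same_derive_forward (fun s => y (q s)) (fun s => y (p s))
      (fun s => / 2 * (x2 (p s) * cosh (theta (L s)) + x1 (p s) * sinh (theta (L s))))
      T T); auto; [|now rewrite q0, p0].
    intros s Hs. split; [|apply Hp, Hs].
    rewrite <- EL, <- E1, <- E2 by auto. apply Hq, Hs.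
  - apply (eq_of_same_derive_forward (fun s => z (q s)) (fun s => z (p s))
      (fun s => (x1 (p s) ^ 2 + x2 (p s) ^ 2) / 2 * sinh (theta (L s)))
      T T); auto; [|now rewrite q0, p0].
    intros s Hs. split; [|apply Hp, Hs].
    rewrite <- EL, <- E1, <- E2 by auto. apply Hq, Hs.
Qed.

Lemma Exp_extremal (l : covector) (T : R) (L : R -> covector) (q : R -> point) :
  0 <= T -> extremal l T L q -> Exp l T = q T.
Proof.
  intros HT H. unfold Exp.
  destruct (epsilon_spec (inhabits origin)
              (fun p => exists L q, extremal l T L q /\ p = q T))
    as (M & r & HM & E).
  - now exists (q T), L, q.
  - rewrite E. now apply (extremal_unique l T M L).
Qed.

Lemma flow_vertical (l : covector) (T : R) (L : R -> covector) :
  0 <= T -> L 0 = l -> vertical_solution L T -> flow T l = L T.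
Proof.
  intros HT H0 V. unfold flow.
  destruct (epsilon_spec (inhabits l)
              (fun p => exists L, L 0 = l /\ vertical_solution L T /\ p = L T))
    as (M & M0 & VM & E).
  - now exists (L T), L.
  - rewrite E. apply (vertical_unique M L T T); auto; [congruence | lra].
Qed.

(** Extremals restrict to shorter segments, so if none existed on [[0, T]], then [T] would bound all
    existence times, against [T < t_supr l]. *)
Lemma domN_extremal (l : covector) (T : R) :
  domN l T -> exists L q, extremal l T L q.
Proof.
  intros [HT Hsup].
  destruct (classic (exists L q, extremal l T L q)) as [H|H]; auto. exfalso.
  apply Rbar_lt_not_le in Hsup. apply Hsup.
  apply (proj2 (Lub_Rbar_correct _)). intros S (HS & L & q & E0 & q0 & V & Hq).
  simpl. destruct (Rle_or_lt S T) as [|HST]; auto. destruct H.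
  exists L, q. split; [|split; [|split]]; auto; intros t Ht; [apply V | apply Hq]; lra.
Qed.

(** * Symmetries *)

Lemma extremal_eps1 (l : covector) (T : R) (L : R -> covector) (q : R -> point) :
  extremal l T L q ->
  extremal (eps1 l) T (fun t => eps1 (L t))
    (fun t => Point (x1 (q t)) (- x2 (q t)) (- y (q t)) (- z (q t))).
Proof.
  intros (L0 & q0 & V & Hq). split; [now rewrite L0|]. split.
  { rewrite q0. apply point_eq; simpl; ring. }
  split; [now apply vertical_eps1|].
  intros t Ht. destruct (Hq t Ht) as (D1 & D2 & D3 & D4). simpl.
  rewrite cosh_opp, sinh_opp. split; [|split; [|split]]; auto.
  - now apply is_derive_Ropp.
  - replace (/ 2 * _) with
      (- (/ 2 * (x2 (q t) * cosh (theta (L t)) + x1 (q t) * sinh (theta (L t)))))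
      by ring.
    now apply is_derive_Ropp.
  - replace (_ * - sinh (theta (L t))) with
      (- ((x1 (q t) ^ 2 + x2 (q t) ^ 2) / 2 * sinh (theta (L t)))) by (simpl; field).
    now apply is_derive_Ropp.
Qed.

(* The left translate of [u] by the inverse of [p] in the Engel group, with the signs
   of its [x1], [x2] and [z] coordinates reversed. *)
Definition reversed_point (p u : point) : point :=
  Point (x1 p - x1 u) (x2 p - x2 u)
    ((x2 p * x1 u - x1 p * x2 u) / 2 - (y p - y u))
    ((x1 p ^ 2 + x2 p ^ 2) / 2 * (x2 p - x2 u)
     - x1 p * ((y p + x1 p * x2 p / 2) - (y u + x1 u * x2 u / 2))
     - x2 p * (x2 p ^ 2 - x2 u ^ 2) / 2 + (z p - z u)).

Lemma is_derive_reverse (f : R -> R) (T s d : R) :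
  is_derive f (T - s) d -> is_derive (fun r => f (T - r)) s (- d).
Proof.
  intros D. replace (- d) with (scal (-1) d)
    by (unfold scal; simpl; unfold mult; simpl; ring).
  apply (is_derive_comp f (fun r => T - r) s d (-1)); auto.
  auto_derive; auto; ring.
Qed.

(** Reversing time negates the horizontal velocity. Left translation brings the new starting point
    [q T] to the origin and respects the left-invariant fields; the sign change in [reversed_point],
    which maps [X1], [X2] to their negatives, restores the direction. *)
Lemma extremal_eps2 (l : covector) (T : R) (L : R -> covector) (q : R -> point) :
  extremal l T L q ->
  extremal (Defs.eps2 (L T)) T (fun s => Defs.eps2 (L (T - s)))
    (fun s => reversed_point (q T) (q (T - s))).
Proof.
  intros (L0 & q0 & V & Hq). split; [now rewrite Rminus_0_r|]. split.
  { rewrite Rminus_0_r. apply point_eq; simpl; field. }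
  split; intros s Hs; assert (Hs' : 0 <= T - s <= T) by lra.
  - destruct (V _ Hs') as (D1 & D2 & D3).
    apply is_derive_reverse in D1, D2, D3. simpl. split; [|split].
    + exact D1.
    + replace (- alpha (L (T - s)) * _)
        with (- - (- alpha (L (T - s)) * cosh (theta (L (T - s))))) by ring.
      now apply is_derive_Ropp.
    + now rewrite Ropp_0 in D3.
  - destruct (Hq _ Hs') as (D1 & D2 & D3 & D4).
    apply is_derive_reverse in D1, D2, D3, D4. simpl.
    set (f1 := fun r => x1 (q (T - r))) in D1.
    set (f2 := fun r => x2 (q (T - r))) in D2.
    set (f3 := fun r => y (q (T - r))) in D3.
    set (f4 := fun r => z (q (T - r))) in D4.
    set (p := q T). split; [|split; [|split]].
    + change (is_derive (fun r => x1 p - f1 r) s (- cosh (theta (L (T - s))))).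
      derive_known.
    + change (is_derive (fun r => x2 p - f2 r) s (sinh (theta (L (T - s))))).
      derive_known.
    + match goal with |- is_derive _ _ ?d => change (is_derive (fun r =>
        (x2 p * f1 r - x1 p * f2 r) / 2 - (y p - f3 r)) s d) end.
      derive_known.
    + match goal with |- is_derive _ _ ?d => change (is_derive (fun r =>
        (x1 p ^ 2 + x2 p ^ 2) / 2 * (x2 p - f2 r)
        - x1 p * ((y p + x1 p * x2 p / 2) - (f3 r + f1 r * f2 r / 2))
        - x2 p * (x2 p ^ 2 - f2 r ^ 2) / 2 + (z p - f4 r)) s d) end.
      derive_known. unfold f1, f2. field.
Qed.

(** The third symmetry thus needs no computation of its own. *)
Lemma eps3_eps1_eps2 (l : covector) : eps3 l = eps1 (Defs.eps2 l).
Proof. apply covector_eq; simpl; ring. Qed.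

(** * Elliptic parametrisation *)

(** With [r = sqrt (e^2 + a^2)] one has [kappa^2 = r / 2] and [k^2 = 1/2 + e / (2 r)], and [a > 0]
    forces [|e| < r]. Solving for [e] and [a^2] makes Legendre's substitution a matter of
    algebra. *)
Lemma modulus_relations (l : covector) :
  0 < alpha l ->
  0 < kappa_plus l /\ 0 < k_plus l ^ 2 < 1 /\
  energy l = 2 * kappa_plus l ^ 2 * (2 * k_plus l ^ 2 - 1) /\
  alpha l ^ 2 = 16 * kappa_plus l ^ 4 * k_plus l ^ 2 * (1 - k_plus l ^ 2).
Proof.
  intros Ha. set (e := energy l). set (a := alpha l) in *.
  set (r := sqrt (e ^ 2 + a ^ 2)).
  assert (Hea : 0 < e ^ 2 + a ^ 2) by (pose proof (pow2_ge_0 e); nra).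
  assert (Hr : 0 < r) by now apply sqrt_lt_R0.
  assert (Hr2 : r ^ 2 = e ^ 2 + a ^ 2) by (apply pow2_sqrt; lra).
  assert (He : - r < e < r) by nra.
  assert (Hk1 : 0 < kappa_plus l) by (apply sqrt_lt_R0; fold e a r; lra).
  assert (Hk2 : kappa_plus l ^ 2 = r / 2).
  { unfold kappa_plus. fold e a r. rewrite pow2_sqrt; lra. }
  assert (Hm : 0 < / 2 + e / (2 * r) < 1).
  { assert (e / (2 * r) < / 2 /\ - / 2 < e / (2 * r)); [|lra].
    split; [apply (Rmult_lt_reg_r (2 * r)) | apply (Rmult_lt_reg_r (2 * r))];
      field_simplify; lra. }
  assert (Hk : k_plus l ^ 2 = / 2 + e / (2 * r)).
  { unfold k_plus. fold e. rewrite Hk2. replace (4 * (r / 2)) with (2 * r) by field.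
    apply pow2_sqrt. lra. }
  rewrite Hk. split; auto. split; auto. split.
  - rewrite Hk2. field. lra.
  - replace (kappa_plus l ^ 4) with ((kappa_plus l ^ 2) ^ 2) by ring.
    rewrite Hk2. field_simplify; [|lra]. nra.
Qed.

Lemma legendre_radicand_pos (k s : R) : k ^ 2 < 1 -> 0 < 1 - k ^ 2 * sin s ^ 2.
Proof.
  intros Hk. pose proof (sin2_cos2 s) as E. unfold Rsqr in E.
  pose proof (pow2_ge_0 k). pose proof (pow2_ge_0 (cos s)).
  pose proof (pow2_ge_0 (sin s)). nra.
Qed.

Lemma legendre_integrand_continuous (k s : R) :
  k ^ 2 < 1 -> continuous (fun r => / sqrt (1 - k ^ 2 * sin r ^ 2)) s.
Proof.
  intros Hk. apply (ex_derive_continuous (fun r => / sqrt (1 - k ^ 2 * sin r ^ 2))).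
  pose proof (legendre_radicand_pos k s Hk) as P. auto_derive. split.
  - simpl in P |- *; lra.
  - split; auto. apply Rgt_not_eq, sqrt_lt_R0. simpl in P |- *; lra.
Qed.

Lemma is_derive_ellF (k u : R) :
  k ^ 2 < 1 -> is_derive (ellF k) u (/ sqrt (1 - k ^ 2 * sin u ^ 2)).
Proof.
  intros Hk.
  apply (is_derive_RInt_0 (fun s => / sqrt (1 - k ^ 2 * sin s ^ 2)) u).
  intros s. now apply legendre_integrand_continuous.
Qed.

Lemma ellF_increasing (k u v : R) : k ^ 2 < 1 -> u < v -> ellF k u < ellF k v.
Proof.
  intros Hk Huv. apply RInt_0_increasing; auto; intros s.
  - now apply legendre_integrand_continuous.
  - now apply Rinv_0_lt_compat, sqrt_lt_R0, legendre_radicand_pos.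
Qed.

Lemma ellF_opp (k u : R) : k ^ 2 < 1 -> ellF k (- u) = - ellF k u.
Proof.
  intros Hk.
  apply (RInt_0_odd (fun s => / sqrt (1 - k ^ 2 * sin s ^ 2)) u); intros s.
  - now apply legendre_integrand_continuous.
  - rewrite sin_neg. now replace ((- sin s) ^ 2) with (sin s ^ 2) by ring.
Qed.

Lemma ellF_inj (k u v : R) : k ^ 2 < 1 -> ellF k u = ellF k v -> u = v.
Proof.
  intros Hk E. destruct (Rtotal_order u v) as [L|[L|L]]; auto;
    apply (ellF_increasing k _ _ Hk) in L; lra.
Qed.

Lemma am_ellF (k u : R) : k ^ 2 < 1 -> am k (ellF k u) = u.
Proof.
  intros Hk. apply (ellF_inj k); auto. unfold am.
  apply (epsilon_spec (inhabits 0) (fun v => ellF k v = ellF k u)). now exists u.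
Qed.

Lemma ellF_onto (k psi : R) :
  k ^ 2 < 1 -> - ellK k < psi < ellK k ->
  exists u, - (PI / 2) < u < PI / 2 /\ ellF k u = psi.
Proof.
  intros Hk Hpsi. pose proof PI_RGT_0 as HPI. unfold ellK in Hpsi.
  rewrite <- (ellF_opp k _ Hk) in Hpsi.
  destruct (IVT_gen (ellF k) (- (PI / 2)) (PI / 2) psi) as [u [Hu E]].
  - intros s. apply derivable_continuous_pt.
    exists (/ sqrt (1 - k ^ 2 * sin s ^ 2)).
    now apply is_derive_Reals, is_derive_ellF.
  - rewrite Rmin_left, Rmax_right; lra.
  - exists u. split; auto. rewrite Rmin_left, Rmax_right in Hu by lra.
    subst psi. split.
    + destruct (Rle_lt_or_eq_dec _ _ (proj1 Hu)) as [|E]; auto. subst u. lra.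
    + destruct (Rle_lt_or_eq_dec _ _ (proj2 Hu)) as [|E]; auto. subst u. lra.
Qed.

(* The substitution [s = 2 kappa tan phi sqrt (1 - k^2 sin^2 phi)] turns the
   differential [slowness ds] into Legendre's [d phi / (kappa sqrt (...))]. *)
Lemma kappa_clock_ellF (l : covector) (u : R) :
  0 < alpha l -> - (PI / 2) < u < PI / 2 ->
  kappa_plus l * clock l
    (2 * kappa_plus l * tan u * sqrt (1 - k_plus l ^ 2 * sin u ^ 2))
  = ellF (k_plus l) u.
Proof.
  intros Ha Hu. destruct (modulus_relations l Ha) as (Hkap & Hk & He & Hal).
  set (kap := kappa_plus l) in *. set (k := k_plus l) in *.
  pose (g := fun u => 2 * kap * tan u * sqrt (1 - k ^ 2 * sin u ^ 2)).
  apply (eq_of_same_derive (fun s => kap * clock l (g s)) (ellF k)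
           (fun s => / sqrt (1 - k ^ 2 * sin s ^ 2)) 0 u).
  - intros s Hs. split; [|apply is_derive_ellF; lra].
    assert (Hc : 0 < cos s).
    { apply cos_gt_0; [apply Rlt_le_trans with (2 := proj1 Hs); apply Rmin_glb_lt
                      | apply Rle_lt_trans with (1 := proj2 Hs); apply Rmax_lub_lt];
        lra. }
    set (D := sqrt (1 - k ^ 2 * sin s ^ 2)).
    pose proof (legendre_radicand_pos k s (proj2 Hk)) as P.
    assert (HD : 0 < D) by now apply sqrt_lt_R0.
    assert (HD2 : D ^ 2 = 1 - k ^ 2 * sin s ^ 2) by (apply pow2_sqrt; lra).
    assert (Hsc : sin s ^ 2 = 1 - cos s ^ 2)
      by (pose proof (sin2_cos2 s) as E; unfold Rsqr in E; lra).
    (* [N] is the numerator in [g'], and the radicand of the slowness at [g s] is the perfect square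
       of [2 kap^2 N / cos^2 s]; so [N] cancels in the chain rule. *)
    set (N := 1 - k ^ 2 + k ^ 2 * cos s ^ 4).
    assert (HN : 0 < N).
    { unfold N. pose proof (pow_lt (cos s) 4 Hc). nra. }
    assert (Dg : is_derive g s (2 * kap * N / (D * cos s ^ 2))).
    { unfold g. auto_derive.
      - split; [eexists; apply is_derive_tan; lra|]. simpl in P |- *. lra.
      - replace (1 + - (k * (k * 1) * (sin s * (sin s * 1))))
          with (1 - k ^ 2 * sin s ^ 2) by ring.
        fold D. pose proof (is_derive_tan s (Rgt_not_eq _ _ Hc)). rewrite_derive.
        unfold tan.
        transitivity (2 * kap / (D * cos s ^ 2)
          * (D ^ 2 * (sin s ^ 2 + cos s ^ 2) - k ^ 2 * sin s ^ 2 * cos s ^ 2)).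
        + field. lra.
        + rewrite HD2, Hsc. unfold N. field. lra. }
    apply (is_derive_clock l _ _ _ Ha) in Dg.
    assert (Hslow : slowness (alpha l) (energy l) (g s)
                    = cos s ^ 2 / (2 * kap ^ 2 * N)).
    { unfold slowness. rewrite He, Hal.
      replace (_ + _) with ((2 * kap ^ 2 * N / cos s ^ 2) ^ 2).
      - rewrite sqrt_pow2; [field; lra|].
        apply Rlt_le, Rdiv_lt_0_compat; [|now apply pow_lt].
        pose proof (pow_lt kap 2 Hkap).
        repeat apply Rmult_lt_0_compat; lra.
      - unfold g. fold D. unfold tan.
        transitivity (16 * kap ^ 4 * k ^ 2 * (1 - k ^ 2)
          + (2 * kap ^ 2 * (sin s ^ 2 * D ^ 2) / cos s ^ 2
             - 2 * kap ^ 2 * (2 * k ^ 2 - 1)) ^ 2).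
        + rewrite HD2, Hsc. unfold N. field. lra.
        + field. lra. }
    replace (/ D) with (kap * (2 * kap * N / (D * cos s ^ 2)
                        * (cos s ^ 2 / (2 * kap ^ 2 * N)))) by (field; lra).
    rewrite Hslow in Dg. apply is_derive_scal; exact Dg.
  - unfold g. rewrite tan_0, Rmult_0_r, Rmult_0_l. unfold clock, ellF.
    rewrite !RInt_point. unfold zero; simpl. ring.
Qed.

(** This supplies the witness showing that the condition defining [psi0_plus] can be met. *)
Lemma c_parametrisation (l : covector) :
  0 < alpha l ->
  exists u, - (PI / 2) < u < PI / 2 /\
    2 * kappa_plus l * tan u * sqrt (1 - k_plus l ^ 2 * sin u ^ 2) = - c l.
Proof.
  intros Ha. destruct (modulus_relations l Ha) as (Hkap & Hk & _).
  set (kap := kappa_plus l) in *. set (k := k_plus l) in *.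
  (* The variable [t = tan u] ranges over the whole line, where the intermediate value theorem
     applies without the poles of [tan]. *)
  pose (h := fun t => 2 * kap * t * sqrt (1 - k ^ 2 * sin (atan t) ^ 2)).
  set (d := sqrt (1 - k ^ 2)).
  assert (Hd : 0 < d) by (apply sqrt_lt_R0; lra).
  (* The square root in [h] is at least [d], so [h M >= |c l|] and [h (- M) <= - |c l|]. *)
  set (M := Rabs (c l) / (2 * kap * d)).
  assert (HM : 0 <= M).
  { apply Rle_mult_inv_pos; [apply Rabs_pos|].
    repeat apply Rmult_lt_0_compat; lra. }
  assert (HMd : 2 * kap * M * d = Rabs (c l)) by (unfold M; field; lra).
  assert (Hs : forall t, d <= sqrt (1 - k ^ 2 * sin (atan t) ^ 2)).
  { intros t. apply sqrt_le_1_alt. pose proof (SIN_bound (atan t)).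
    assert (sin (atan t) ^ 2 <= 1) by nra. nra. }
  destruct (IVT_gen h (- M) M (- c l)) as [t [_ Et]].
  - intros t. apply derivable_continuous_pt, ex_derive_Reals_0. unfold h.
    pose proof (legendre_radicand_pos k (atan t) (proj2 Hk)) as P.
    auto_derive. simpl in P |- *. lra.
  - assert (HkM : 0 <= 2 * kap * M) by nra.
    pose proof (Rmult_le_compat_l _ _ _ HkM (Hs M)).
    pose proof (Rmult_le_compat_l _ _ _ HkM (Hs (- M))).
    pose proof (Rle_abs (c l)). pose proof (Rle_abs (- c l)) as Hn.
    rewrite Rabs_Ropp in Hn.
    split; [eapply Rle_trans; [apply Rmin_l|] | eapply Rle_trans; [|apply Rmax_r]];
      unfold h; lra.
  - exists (atan t). pose proof (atan_bound t). split; [lra|]. now rewrite tan_atan.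
Qed.

Lemma psi0_plus_clock (l : covector) :
  0 < alpha l -> psi0_plus l = - kappa_plus l * clock l (c l).
Proof.
  intros Ha. destruct (modulus_relations l Ha) as (_ & Hk & _).
  unfold psi0_plus.
  match goal with |- epsilon ?i ?P = _ =>
    destruct (epsilon_spec i P) as [Hpsi E]; [|set (psi := epsilon i P) in *] end.
  (* The condition is satisfiable, so [epsilon] returns a genuine solution. *)
  - destruct (c_parametrisation l Ha) as (u & Hu & E).
    exists (ellF (k_plus l) u). split.
    + unfold ellK. rewrite <- ellF_opp by lra. split; apply ellF_increasing; lra.
    + unfold sn, cn, dn, sn. rewrite am_ellF by lra. fold (tan u). lra.
  (* Any solution is [ellF u] with [|u| < PI / 2]; then [sn / cn * dn] is [tan u * sqrt (...)], and
     the substitution evaluates the clock at [- c l]. *)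
  - destruct (ellF_onto (k_plus l) psi) as (u & Hu & Eu); auto; [lra|].
    rewrite <- Eu in E |- *. unfold sn, cn, dn, sn in E.
    rewrite am_ellF in E by lra. fold (tan u) in E.
    rewrite <- (kappa_clock_ellF l u Ha Hu).
    replace (2 * kappa_plus l * tan u * _) with (- c l) by (rewrite E; ring).
    rewrite clock_opp by auto. ring.
Qed.

Lemma tau_eps1 (l : covector) (T : R) : alpha l < 0 -> tau l T = tau (eps1 l) T.
Proof.
  intros Ha. unfold tau, psi0, kappa, to_plus.
  destruct (Rlt_dec 0 (alpha l)); [lra|].
  destruct (Rlt_dec 0 (alpha (eps1 l))) as [|Hn]; auto.
  destruct Hn. simpl. lra.
Qed.

Lemma tau_clock (l : covector) (T : R) :
  0 < alpha l -> tau l T = kappa_plus l * (T / 2 - clock l (c l)).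
Proof.
  intros Ha. unfold tau, psi0, kappa, to_plus.
  destruct (Rlt_dec 0 (alpha l)); [|lra].
  rewrite psi0_plus_clock by auto. field.
Qed.

Lemma eps2_fixed_iff (L : R -> covector) (T : R) :
  0 <= T -> vertical_solution L T -> 0 < alpha (L 0) ->
  Defs.eps2 (L T) = L 0 <-> tau (L 0) T = 0.
Proof.
  intros HT V Ha. assert (HTT : 0 <= T <= T) by lra.
  pose proof (clock_runs_backwards L T T Ha V HTT) as HC.
  pose proof (alpha_constant L T T V HTT) as Ea.
  pose proof (energy_constant L T T V HTT) as Ee.
  destruct (modulus_relations _ Ha) as (Hkap & _).
  rewrite tau_clock by auto. split.
  - intros E. assert (Ec : - c (L T) = c (L 0)) by exact (f_equal c E).
    rewrite <- Ec, clock_opp in HC by auto.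
    rewrite <- Ec, clock_opp by auto. nra.
  - intros E. apply Rmult_integral in E.
    assert (Ec : - c (L T) = c (L 0)).
    { apply (clock_inj (L 0)); auto. rewrite clock_opp by auto. lra. }
    (* The energy is even in [c], so its conservation gives equal values of [sinh theta] at both
       ends. *)
    apply covector_eq; simpl; auto.
    unfold energy in Ee. rewrite Ea, <- Ec in Ee.
    apply sinh_inj, (Rmult_eq_reg_l (alpha (L 0))); lra.
Qed.

(** * Fixed points and Maxwell sets *)

Lemma lam2_fixed_iff (l : covector) (T : R) (L : R -> covector) :
  0 < T -> L 0 = l -> vertical_solution L T ->
  lam2 l T = l <-> C_00 l \/ ((C_pos l \/ C_neg l) /\ tau l T = 0).
Proof.
  intros HT HL V. unfold lam2, C_00, C_pos, C_neg.
  rewrite (flow_vertical l T L) by (auto; lra). subst l.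
  destruct (Rtotal_order (alpha (L 0)) 0) as [Ha|[Ha|Ha]].
  (* For [alpha < 0], conjugate by [eps1], which commutes with [eps2]. *)
  - rewrite tau_eps1 by auto.
    pose proof (eps2_fixed_iff (fun t => eps1 (L t)) T) as H. simpl in H.
    rewrite <- H by (auto using vertical_eps1; lra).
    replace (Defs.eps2 (eps1 (L T))) with (eps1 (Defs.eps2 (L T)))
      by (apply covector_eq; simpl; ring).
    split; [intros ->; right; split; [lra|auto]|].
    intros [E|[_ E]]; [lra|].
    rewrite <- (eps1_involutive (L 0)), <- E. symmetry. apply eps1_involutive.
  (* For [alpha = 0], [c] is constant, so a fixed point means [- c = c]. *)
  - rewrite (vertical_zero L T T) by (auto; lra). split.
    + intros E. pose proof (f_equal c E) as Ec. simpl in Ec. lra.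
    + intros E. apply covector_eq; simpl; auto; nra.
  - rewrite eps2_fixed_iff by (auto; lra). intuition lra.
Qed.

(** [eps3] negates the conserved [alpha], so a fixed point has [alpha = 0]. Then [theta] at time [T]
    is [theta l - c l * T], and its negative has to equal [theta l]. *)
Lemma lam3_fixed_iff (l : covector) (T : R) (L : R -> covector) :
  0 < T -> L 0 = l -> vertical_solution L T ->
  lam3 l T = l <-> (C_0 l \/ C_00 l) /\ theta l = c l * T / 2.
Proof.
  intros HT HL V. unfold lam3, C_00, C_0.
  rewrite (flow_vertical l T L) by (auto; lra). subst l.
  destruct (Req_dec (alpha (L 0)) 0) as [Ha|Ha].
  - rewrite (vertical_zero L T T) by (auto; lra). split.
    + intros E. pose proof (f_equal theta E) as Et. simpl in Et.
      split; [|lra]. destruct (Req_dec (c (L 0)) 0); auto.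
    + intros [_ E]. apply covector_eq; simpl; lra.
  - split; [|intros [[[_ E]|[_ E]] _]; lra].
    intros E. pose proof (f_equal alpha E) as Ea. simpl in Ea.
    rewrite (alpha_constant L T T) in Ea by (auto; lra). lra.
Qed.

Theorem theorem4 (l : covector) (T : R) (hN : domN l T) :
  (MAX1 l T <->
     x2 (Exp l T) = 0 /\ y (Exp l T) = 0 /\ z (Exp l T) = 0 /\
     (C_00 l -> theta l <> 0)) /\
  (MAX2 l T <->
     ((C_pos l \/ C_neg l) /\ y (Exp l T) = 0 /\ tau l T <> 0) \/
     (C_0 l /\ y (Exp l T) = 0)) /\
  (MAX3 l T <->
     x2 (Exp l T) = 0 /\ z (Exp l T) = x1 (Exp l T) * y (Exp l T) / 2 /\
     (C_0 l \/ C_00 l -> theta l <> c l * T / 2)).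
Proof.
  destruct (domN_extremal l T hN) as (L & q & HE).
  assert (HT : 0 < T) by apply hN. assert (HT0 : 0 <= T) by lra.
  pose proof HE as (L0 & q0 & V & _).
  pose proof (lam2_fixed_iff l T L HT L0 V) as F2.
  pose proof (lam3_fixed_iff l T L HT L0 V) as F3.
  assert (E1 := extremal_eps1 _ _ _ _ HE).
  assert (E2 := extremal_eps2 _ _ _ _ HE).
  assert (E3 := extremal_eps1 _ _ _ _ E2).
  apply Exp_extremal in E1, E2, E3; auto.
  rewrite <- eps3_eps1_eps2 in E3.
  rewrite <- (flow_vertical l T L) in E2, E3 by auto.
  fold (lam2 l T) in E2. fold (lam3 l T) in E3. fold (lam1 l T) in E1.
  (* The reversed curve ends at the image of the original starting point, the origin. *)
  rewrite Rminus_diag, q0 in E2, E3. simpl in E2, E3.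
  unfold MAX1, MAX2, MAX3, Maxwell. rewrite E1, E2, E3.
  rewrite (Exp_extremal l T L q HT0 HE). set (p := q T).
  unfold lam1.
  split; [|split].
  (* [eps1] fixes only the zero covector, that is, the point of [C_00] with [theta = 0]. *)
  - split.
    + intros (_ & Hne & E).
      pose proof (f_equal x2 E). pose proof (f_equal y E). pose proof (f_equal z E).
      simpl in *. repeat split; try lra.
      intros [Hc Ha] Ht. apply Hne, covector_eq; simpl; lra.
    + intros (H2 & Hy & Hz & Hne). split; auto. split.
      * intros E. pose proof (f_equal theta E). pose proof (f_equal c E).
        pose proof (f_equal alpha E). simpl in *.
        apply Hne; [split; lra|lra].
      * apply point_eq; simpl; lra.
  - rewrite F2.
    (* The [y] and [z] coordinates of the image are [- y p] and [z p - x1 p * y p], so [y p = 0]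
       already matches both. *)
    assert (Ey : reversed_point p origin = p <-> y p = 0).
    { split.
      - intros E. apply (f_equal y) in E. simpl in E. lra.
      - intros E. apply point_eq; simpl; rewrite ?E; field. }
    unfold reversed_point in Ey. simpl in Ey. rewrite Ey.
    unfold C_00, C_0, C_pos, C_neg.
    (* Splitting by strata leaves a propositional check. *)
    destruct (Rtotal_order (alpha l) 0) as [Ha|[Ha|Ha]];
    destruct (Req_dec (c l) 0) as [Hc|Hc]; intuition lra.
  - rewrite F3.
    (* The image is [(x1, - x2, y, x1 y - z)], so equality with [p] means [x2 = 0] and
       [2 z = x1 y]. *)
    match goal with |- (_ /\ _ /\ ?A) <-> _ =>
      assert (Ez : A <-> x2 p = 0 /\ z p = x1 p * y p / 2) end.
    { split.
      - intros E. pose proof (f_equal x2 E) as H2. pose proof (f_equal z E) as Hz.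
        simpl in *. assert (H2' : x2 p = 0) by lra. rewrite H2' in Hz. lra.
      - intros [H2 Hz]. apply point_eq; simpl; rewrite ?H2, ?Hz; field. }
    rewrite Ez. tauto.
Qed.
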